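(* Let $m\ge 2$ be an integer, $A=[a]_m$, $B=[b]_m$, $Y_0=[y_0]_m\in\mathbb{Z}_m$, and let $F_n=[f_n]_m$ $(n\in\mathbb{Z}_+)$ be a sequence in $\mathbb{Z}_m$, where $a,b,y_0,f_n\in\mathbb{Z}$. Consider the initial problem (IP) for sequences $\{X_n\}_{n=0}^\infty$ in $\mathbb{Z}_m$: $$BX_{n+1}=AX_n+F_n\ (n\in\mathbb{Z}_+),\qquad X_0=Y_0.$$ With $d,m_i,m',m_i',A_i,B_i,Y_{i,0},F_{i,n},A',B',A_i',B_i',Y_0',Y_{i,0}',F_n',F_{i,n}',\psi$ as defined in the context, the following hold. 1. (IP) has a unique solution if and only if $d=1$ and one of the following holds: (a) $m_2=1$; (b) $m_2\ne 1$ and $$Y_{2,0}=-\sum_{s=0}^{\mathrm{ind}(B_2)-1}A_2^{-s-1}B_2^sF_{2,s}.$$ Moreover, in this case the unique solution is given for $n\in\mathbb{Z}_+$ by - if $m_2=1$: $X_n=B^{-n}A^nY_0+\sum_{s=0}^{n-1}A^sB^{-s-1}F_{n-s-1}$; - if $m_1=1$: $X_n=-\sum_{s=0}^{\mathrm{ind}(B)-1}A^{-s-1}B^sF_{n+s}$; - if $m_1\neq1$ and $m_2\ne1$: $X_n=\psi\Big(B_1^{-n}A_1^nY_{1,0}+\sum_{s=0}^{n-1}A_1^sB_1^{-s-1}F_{1,n-s-1},\ -\sum_{s=0}^{\mathrm{ind}(B_2)-1}A_2^{-s-1}B_2^sF_{2,n+s}\Big)$. 2. (IP) has infinitely many solutions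 if and only if $d\ne1$, $d\mid f_n$ for all $n\in\mathbb{Z}_+$, and one of the following holds: (a) $m_2'=1$; (b) $m_2'\neq1$ and $$Y_{2,0}'=-\sum_{s=0}^{\mathrm{ind}(B_2')-1}(A_2')^{-s-1}(B_2')^sF_{2,s}'.\qquad( * )$$ In this case the initial problem $B'X'_{n+1}=A'X'_n+F'_n$ $(n\in\mathbb{Z}_+)$, $X'_0=Y'_0$ over $\mathbb{Z}_{m'}$ has a unique solution $X'_n=[x'_n]_{m'}$ $(n\in\mathbb{Z}_+)$, and (with integer representatives $x_n'$ fixed) the general solution of (IP) is given by $X_0=Y_0$ and $$X_n=[x'_n+\alpha_n m']_m,\quad n\in\mathbb{N},$$ where $\{\alpha_n\}_{n=1}^\infty$ is an arbitrary sequence of elements of $\{0,1,\ldots,d-1\}$. Moreover, the sequence $\{\alpha_n\}_{n=1}^\infty$ is uniquely determined by the solution $\{X_n\}_{n=0}^\infty$ of (IP). 3. (IP) has no solutions if and only if one of the following holds: (a) $d\nmid f_n$ for some $n\in\mathbb{Z}_+$; (b) $d\mid f_n$ for all $n\in\mathbb{Z}_+$, $m_2'\ne1$, and equality $( * )$ fails.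
   Context: $\mathbb{Z}_+$ is the set of non-negative integers, $\mathbb{N}$ the positive integers. $\mathbb{Z}_s=\mathbb{Z}/s\mathbb{Z}$ and $[t]_s$ is the class of $t\in\mathbb{Z}$ in $\mathbb{Z}_s$; $\mathbb{Z}_1$ is the null ring. For a nilpotent element $T$, $\mathrm{ind}(T)$ is its nilpotency index (least $k\ge1$ with $T^k=0$). Zeroth powers are $1$ and empty sums are $0$. Write $m=\prod_{j=1}^r p_j^{k_j}$ with distinct primes $p_j$ and $k_j\in\mathbb{N}$. Put $m_1=\prod_{j:\,p_j\nmid b}p_j^{k_j}$, $m_2=\prod_{j:\,p_j\mid b}p_j^{k_j}$ (empty products are $1$); so $m=m_1m_2$ and $\gcd(m_1,m_2)=1$. Put $d=\gcd(a,b,m)$ (positive). For $i=1,2$: $A_i=[a]_{m_i}$, $B_i=[b]_{m_i}$, $Y_{i,0}=[y_0]_{m_i}$, $F_{i,n}=[f_n]_{m_i}$. If $m_1\ne1$ and $m_2\neq 1$, $\psi:\mathbb{Z}_{m_1}\oplus\mathbb{Z}_{m_2}\to\mathbb{Z}_m$ is the ring isomorphism $\psi([t_1]_{m_1},[t_2]_{m_2})=[t_1e_1m_2+t_2e_2m_1]_m$, where $[e_1]_{m_1}=[m_2]_{m_1}^{-1}$, $[e_2]_{m_2}=[m_1]_{m_2}^{-1}$. Put $m'=m/d=\prod_{j=1}^r p_j^{l_j}$ with integers $0\le l_j\le k_j$, $m_1'=\prod_{j:\,dp_j\nmid b}p_j^{l_j}$, $m_2'=\prod_{j:\,dp_j\mid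 b}p_j^{l_j}$ (empty products are $1$). Put $A'=[a/d]_{m'}$, $B'=[b/d]_{m'}$, $Y_0'=[y_0]_{m'}$, and for $i=1,2$: $A_i'=[a/d]_{m_i'}$, $B_i'=[b/d]_{m_i'}$, $Y_{i,0}'=[y_0]_{m_i'}$. When $d\mid f_n$ for all $n$, put $F_n'=[f_n/d]_{m'}$ and $F_{i,n}'=[f_n/d]_{m_i'}$. The formulas make sense: $B_1$ is invertible if $m_1\neq1$; $B_2$ is nilpotent if $m_2\ne1$, and then $A_2$ is invertible if $d=1$; likewise $B_2'$ is nilpotent and $A_2'$ is invertible in $\mathbb{Z}_{m_2'}$ if $m_2'\ne1$. (If $m_2=1$ then $B=B_1$; if $m_1=1$ then $B=B_2$, $A=A_2$.) *)

(* Defs.v *)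
From HB Require Import structures.
From mathcomp Require Import all_boot all_order all_algebra.
From mathcomp Require Import boolp classical_sets functions cardinality.

Set Implicit Arguments.
Unset Strict Implicit.
Unset Printing Implicit Defensive.

Import GRing.Theory.
Local Open Scope ring_scope.

(* MathComp's ['Z_s] is Z/sZ only for s >= 2 (['Z_1] is Z/2Z), and it is used
   below only for such s.  [Zmod s] is Z/sZ for every s >= 1, the null ring for
   s = 1; for s = k.+2 it is convertible to ['Z_s] as a type. *)
Definition Zmod (s : nat) : Type := 'I_s.-1.+1.

HB.instance Definition _ (s : nat) := GRing.Zmodule.on (Zmod s).
HB.instance Definition _ (s : nat) := Finite.on (Zmod s).
HB.instance Definition _ (s : nat) :=
  GRing.Zmodule_isComPzRing.Build (Zmod s)
    (@Zp_mulA _) (@Zp_mulC _) (@Zp_mul1z _) (@Zp_mul_addl _).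

Lemma Zmod_intr_eq0 (s : nat) (t : int) :
  (0 < s)%N -> (t%:~R == 0 :> Zmod s) = (s %| t)%Z.
Proof.
have natE (n : nat) : n%:R = inZp n :> Zmod s.
  by apply: val_inj; rewrite /= [n%:R]Zp_mulrn /= modnMml mul1n.
have nat0 (n : nat) : (0 < s)%N -> (n%:R == 0 :> Zmod s) = (s %| n)%N.
  by move=> s_gt0; rewrite natE -val_eqE /= prednK.
move=> s_gt0; case: t => n; rewrite dvdzE /=.
  by rewrite -pmulrn nat0.
by rewrite NegzE rmorphN /= oppr_eq0 -pmulrn nat0.
Qed.

(* Nilpotency index: the least k >= 1 with T ^+ k = 0 (junk value 0 when T is
   not nilpotent). *)
Definition ind (R : pzRingType) (T : R) : nat :=
  if pselect (exists k, (0 < k)%N && (T ^+ k == 0)) is left nilT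
  then ex_minn nilT else 0%N.

Lemma indP (R : pzRingType) (T : R) (k : nat) :
  (0 < k)%N -> T ^+ k = 0 ->
  [/\ (0 < ind T)%N, T ^+ ind T = 0 &
      forall j, (0 < j)%N -> T ^+ j = 0 -> (ind T <= j)%N].
Proof.
move=> k_gt0 Tk0; rewrite /ind; case: pselect => [nilT|]; last first.
  by case; exists k; rewrite k_gt0 Tk0 eqxx.
case: ex_minnP => i /andP[i_gt0 /eqP Ti0] imin; split=> // j j_gt0 Tj0.
by apply: imin; rewrite j_gt0 Tj0 eqxx.
Qed.

Definition IP (R : pzRingType) (A B Y0 : R) (F : nat -> R) (X : nat -> R) :=
  (forall n, B * X n.+1 = A * X n + F n) /\ X 0%N = Y0.

(* Explicit solution when B is invertible. *)
Definition explicit_sol (R : unitRingType) (A B Y0 : R) (F : nat -> R)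
    (n : nat) : R :=
  B ^- n * A ^+ n * Y0 +
  \sum_(0 <= s < n) A ^+ s * B ^- s.+1 * F (n - s - 1)%N.

(* Explicit solution when A is invertible and B is nilpotent. *)
Definition implicit_sol (R : unitRingType) (A B : R) (F : nat -> R)
    (n : nat) : R :=
  - \sum_(0 <= s < ind B) A ^- s.+1 * B ^+ s * F (n + s)%N.

(* Elements of ['Z_m1], ['Z_m2] coerce to their representatives in nat; for
   coprime m1, m2 >= 2 with m = m1 * m2 the result does not depend on the choice
   of the representatives t1, t2, e1, e2. *)
Definition psi (m m1 m2 : nat) (t1 : 'Z_m1) (t2 : 'Z_m2) : 'Z_m :=
  let e1 : 'Z_m1 := m2%:R^-1 in
  let e2 : 'Z_m2 := m1%:R^-1 in
  (t1 * e1 * m2 + t2 * e2 * m1)%N%:R.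

(* Main.v *)
Require Import Defs.
From HB Require Import structures.
From mathcomp Require Import all_boot all_order all_algebra.
From mathcomp Require Import boolp classical_sets functions cardinality.
From mathcomp Require Import ring.

Set Implicit Arguments.
Unset Strict Implicit.
Unset Printing Implicit Defensive.

Import GRing.Theory.
Local Open Scope ring_scope.

(** A solution modulo [m] forces [d] to divide every [f n], and dividing the
    recurrence by [d] leaves a recurrence modulo [m' = m / d] with coprime data;
    the residues modulo [m] of the terms of index [n >= 1] are then free over
    their residues modulo [m'], while the term of index 0 is fixed.  When the
    data are coprime, the Chinese remainder theorem splits the modulus into
    [m1], where [B] is invertible and the recurrence can be solved forwards from
    any initial value, and [m2], where [B] is nilpotent and [A] invertible.
    There [X n] can be expressed through [B ^+ k * X (n + k)] for every [k], so
    nilpotency determines the whole sequence, including its initial value. *)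

(** * Closed formulas: forward for invertible [B], backward for invertible [A] and nilpotent [B] *)

Lemma explicit_solS (R : comUnitRingType) (A B Y0 : R) (F : nat -> R) n :
  explicit_sol A B Y0 F n.+1 = B^-1 * (A * explicit_sol A B Y0 F n + F n).
Proof.
(* The term [s = 0] of the sum is [B^-1 * F n]; each later term carries one more factor [A * B^-1]
   than the corresponding term at [n]. *)
rewrite /explicit_sol big_nat_recl // expr0 mul1r !subn1 expr1.
under eq_bigr => s _ do rewrite subSS -[B ^- s.+2]exprVn !exprS exprVn.
rewrite -!exprVn !exprS !mulrDr mulr_sumr mulr_sumr [_ + B^-1 * F n]addrC.
rewrite !addrA [X in X + _ = _]addrC; congr (_ + _); first by congr (_ + _); ring.
by apply: eq_bigr => s _; rewrite -!exprVn !exprS; ring.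
Qed.

Lemma explicit_solP (R : comUnitRingType) (A B Y0 : R) (F X : nat -> R) :
  B \is a GRing.unit ->
  IP A B Y0 F X <-> forall n, X n = explicit_sol A B Y0 F n.
Proof.
move=> uB; have sol0 : explicit_sol A B Y0 F 0 = Y0.
  by rewrite /explicit_sol big_geq // addr0 !expr0 invr1 !mul1r.
split=> [[recX X0] | eqX].
  elim=> [|n IHn]; first by rewrite sol0.
  by rewrite explicit_solS -IHn -recX mulKr.
split=> [n|]; last by rewrite eqX.
by rewrite !eqX explicit_solS mulVKr.
Qed.

(** Solving for the earlier term gives [X n = A^-1 * (B * X n.+1 - F n)]; this is substituted into
    itself [k] times. *)
Lemma backward_iter (R : comUnitRingType) (A B : R) (F X : nat -> R) k n :
  A \is a GRing.unit -> (forall j, B * X j.+1 = A * X j + F j) ->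
  X n = A ^- k * B ^+ k * X (n + k)%N
        - \sum_(0 <= s < k) A ^- s.+1 * B ^+ s * F (n + s)%N.
Proof.
move=> uA recX; elim: k => [|k IHk].
  by rewrite big_geq // subr0 addn0 !expr0 invr1 !mul1r.
have Xnk : X (n + k)%N = A^-1 * (B * X (n + k.+1)%N - F (n + k)%N).
  by rewrite addnS recX addrK mulKr.
rewrite big_nat_recr //= {1}IHk {1}Xnk -!exprVn !exprS; ring.
Qed.

(** Iterating backwards [ind B] times kills the remainder, so the recurrence alone fixes the
    sequence; hence no initial value occurs. The number [k] only witnesses nilpotency. *)
Lemma implicit_solP (R : comUnitRingType) (A B : R) (F X : nat -> R) k :
  A \is a GRing.unit -> (0 < k)%N -> B ^+ k = 0 ->
  (forall n, B * X n.+1 = A * X n + F n) <->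
  forall n, X n = implicit_sol A B F n.
Proof.
move=> uA k_gt0 Bk0; have [ind_gt0 Bind0 _] := indP k_gt0 Bk0.
split=> [recX n | eqX n].
  by rewrite (backward_iter (ind B) n uA recX) Bind0 mulr0 mul0r add0r.
rewrite !{}eqX /implicit_sol.
(* Telescoping: up to sign, [A * X n] is the sum over [s < ind B] and [B * X n.+1] the same sum
   shifted by one. The extra last term vanishes by nilpotency, and the unmatched term [s = 0] is
   [F n]. *)
have: \sum_(0 <= s < (ind B).+1) A ^- s * B ^+ s * F (n + s)%N =
      \sum_(0 <= s < ind B) A ^- s * B ^+ s * F (n + s)%N.
  by rewrite big_nat_recr //= Bind0 mulr0 mul0r addr0.
rewrite big_nat_recl // !expr0 invr1 !mul1r addn0 => sumE.
rewrite -[F n](addrK (\sum_(0 <= i < ind B) A ^- i.+1 * B ^+ i.+1 * F (n + i.+1)%N)).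
rewrite sumE !mulrN !mulr_sumr.
have -> : \sum_(0 <= i < ind B) A * (A ^- i.+1 * B ^+ i * F (n + i)%N) =
          \sum_(0 <= s < ind B) A ^- s * B ^+ s * F (n + s)%N.
  by apply: eq_bigr => s _; rewrite -!exprVn exprS -!mulrA mulVKr.
rewrite addrA addNr add0r; congr (- _); apply: eq_bigr => s _.
by rewrite addSnnS [B ^+ s.+1]exprS; ring.
Qed.

(** * Passing between residues and integers *)

(* Integer representatives make sense for every modulus [s], whereas ['Z_s] is not
   Z/sZ for [s = 1]. *)
Definition int_IP (s : nat) (a b y : int) (f x : nat -> int) :=
  (forall n, (s %| b * x n.+1 - (a * x n + f n))%Z) /\ (s %| x 0%N - y)%Z.

Lemma Zp_intr_eq0 (s : nat) (t : int) :
  (1 < s)%N -> (t%:~R == 0 :> 'Z_s) = (s %| t)%Z.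
Proof. by case: s => [|[|s]] // _; exact: (@Zmod_intr_eq0 s.+2). Qed.

Section Transfer.

Variables (s : nat) (R : pzRingType).
(** Stated abstractly so that it covers both ['Z_s] for [s >= 2] and [Zmod s] for [s >= 1]. *)
Hypothesis intr_eq0 : forall t : int, (t%:~R == 0 :> R) = (s %| t)%Z.

Lemma intr_eqP (t u : int) : t%:~R = u%:~R :> R <-> (s %| t - u)%Z.
Proof. by rewrite -intr_eq0 rmorphB subr_eq0; split=> /eqP. Qed.

Lemma IP_intrP (a b y : int) (f x : nat -> int) :
  IP (a%:~R : R) b%:~R y%:~R (fun n => (f n)%:~R) (fun n => (x n)%:~R) <->
  int_IP s a b y f x.
Proof.
split=> -[recx x0]; (split=> [n|]; last exact/intr_eqP).
  by apply/intr_eqP; rewrite rmorphM rmorphD rmorphM recx.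
by rewrite -!rmorphM -rmorphD; apply/intr_eqP.
Qed.

End Transfer.

Lemma Zmod_intr_repr s (x : Zmod s) : (nat_of_ord x)%:Z%:~R = x.
Proof.
by apply: val_inj; rewrite /= -pmulrn [_%:R]Zp_mulrn /= modnMml mul1n modn_small.
Qed.

Lemma Zp_intr_repr s (x : 'Z_s) : (nat_of_ord x)%:Z%:~R = x.
Proof. by rewrite -pmulrn natr_Zp. Qed.

Lemma Zp_intr_unit s (t : int) :
  (1 < s)%N -> ((t%:~R : 'Z_s) \is a GRing.unit) = coprime s `|t|.
Proof.
move=> s_gt1; case: t => n; first by rewrite -pmulrn unitZpE.
by rewrite NegzE mulrNz unitrN -pmulrn unitZpE.
Qed.

Lemma Zp_intr_nilpotent s (t : int) k :
  (1 < s)%N -> (s %| t ^+ k)%Z -> (t%:~R : 'Z_s) ^+ k = 0.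
Proof. by move=> s_gt1 dvd_s; apply/eqP; rewrite -rmorphXn /= Zp_intr_eq0. Qed.

(** * Factoring the modulus according to the primes dividing [b] *)

Lemma prod_primes_partn N m (P : pred nat) : (0 < N)%N -> (m %| N)%N ->
  (\prod_(p <- primes N | P p) p ^ logn p m)%N = (m`_[pred p | P p])%N.
Proof.
move=> N_gt0 dvd_mN; have m_gt0 := dvdn_gt0 N_gt0 dvd_mN.
rewrite (widen_partn _ (dvdn_leq N_gt0 dvd_mN)).
rewrite -(filter_pi_of (ltnSn N)) big_filter_cond.
(* Indices outside [\pi(N)] contribute [p ^ 0 = 1]: such a [p] is not prime or does not divide [N],
   hence not [m]. *)
rewrite [RHS](bigID (fun p => p \in \pi(N))) /= [X in (_ * X)%N]big1 ?muln1.
  by apply: eq_bigl => p; rewrite andbC.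
move=> p /andP[_]; rewrite mem_primes N_gt0 /= negb_and => npN.
rewrite (_ : logn p m = 0)%N // lognE m_gt0 /=.
case: ifP => // /andP[pr_p dvd_pm]; move: npN.
by rewrite pr_p (dvdn_trans dvd_pm dvd_mN).
Qed.

Lemma coprime_no_prime u v : (0 < v)%N ->
  (forall p, prime p -> (p %| v)%N -> ~~ (p %| u)%N) -> coprime u v.
Proof.
move=> v_gt0 no_p; have g_gt0 : (0 < gcdn u v)%N by rewrite gcdn_gt0 v_gt0 orbT.
rewrite /coprime eqn_leq g_gt0 andbT leqNgt; apply/negP => /pdiv_prime pr_p.
have := no_p _ pr_p (dvdn_trans (pdiv_dvd _) (dvdn_gcdr _ _)).
by rewrite (dvdn_trans (pdiv_dvd _) (dvdn_gcdl _ _)).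
Qed.

(** Encodes that [b] is a unit modulo [m1], while modulo [m2] [a] is a unit and [b] is nilpotent.
    Arithmetic conditions are used because they also make sense when a factor is 1. *)
Definition splitting (a b : int) (m1 m2 : nat) :=
  [/\ (0 < m1)%N /\ (0 < m2)%N, coprime m1 m2, coprime m1 `|b|,
      coprime m2 `|a| & (exists2 k, (0 < k)%N & (m2 %| b ^+ k)%Z)].

(** The factors are the parts of [m] prime to [b] and supported on primes of [b]. Keeping [N] apart
    from [m] allows products over the primes of the original modulus to describe [m'] as well. *)
Lemma prod_primes_splitting N m (a b : int) : (0 < N)%N -> (m %| N)%N ->
  (forall p, prime p -> (p %| m)%N -> (p %| a)%Z -> ~~ (p %| b)%Z) ->
  let m1 := (\prod_(p <- primes N | ~~ (p %| b)%Z) p ^ logn p m)%N in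
  let m2 := (\prod_(p <- primes N | (p %| b)%Z) p ^ logn p m)%N in
  splitting a b m1 m2 /\ m = (m1 * m2)%N.
Proof.
move=> N_gt0 dvd_mN no_p; have m_gt0 := dvdn_gt0 N_gt0 dvd_mN.
rewrite (prod_primes_partn (fun p => ~~ (p %| b)%Z)) //.
rewrite (prod_primes_partn (fun p => (p %| b)%Z)) //=.
set pi := [pred p : nat | (p %| b)%Z].
have -> : (m`_[pred p : nat | ~~ (p %| b)%Z] = m`_pi^')%N by apply: eq_partn.
have piP p : prime p -> (p %| m`_pi)%N -> (p %| b)%Z.
  by move=> pr_p; apply: (pnatP pi (part_gt0 _ _) (part_pnat pi m)).
split; last by rewrite mulnC partnC.
split; rewrite ?part_gt0 //.
- by rewrite coprime_sym coprime_partC.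
- rewrite coprime_sym; apply: coprime_no_prime; rewrite ?part_gt0 // => p pr_p.
  by move/(pnatP _ (part_gt0 _ _) (part_pnat pi^' m) _ pr_p).
- rewrite coprime_sym; apply: coprime_no_prime; rewrite ?part_gt0 // => p pr_p p2.
  apply: contraL (piP _ pr_p p2) => pa; apply: no_p => //.
  exact: dvdn_trans p2 (dvdn_part _ _).
(* The exponent [m] suffices because [logn p m < m] for every prime [p]. *)
- exists m => //; rewrite dvdzE abszX; apply/dvdn_partP; rewrite ?part_gt0 // => p.
  rewrite mem_primes part_gt0 /= => /andP[pr_p p2].
  rewrite p_part; have /(dvdn_exp2r m) := piP _ pr_p p2; apply: dvdn_trans.
  apply: dvdn_exp2l; apply: (@leq_trans (logn p m)); last first.
    by rewrite ltnW // ltn_logl.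
  exact: dvdn_leq_log (dvdn_part _ _).
Qed.

(** * Coprime data and the Chinese remainder theorem *)

Lemma int_IP_mul s t (a b y : int) (f x : nat -> int) : coprime s t ->
  int_IP (s * t) a b y f x <-> int_IP s a b y f x /\ int_IP t a b y f x.
Proof.
move=> co_st; have dvdE u : ((s * t)%N %| u)%Z = (s %| u)%Z && (t %| u)%Z.
  by rewrite PoszM Gauss_dvdz.
rewrite /int_IP dvdE; split.
  move=> [recx /andP[xs xt]]; split; split=> // n;
    by have := recx n; rewrite dvdE => /andP[].
by move=> [[recs -> ] [rect ->]]; split=> // n; rewrite dvdE recs rect.
Qed.

Lemma int_IP1 (a b y : int) (f x : nat -> int) : int_IP 1 a b y f x.
Proof. by split=> [n|]; exact: dvd1z. Qed.

Lemma gt1_neq1 s : (0 < s)%N -> s <> 1%N <-> (1 < s)%N.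
Proof. by case: s => [|[|s]]. Qed.

Section Coprime.

Variables (m m1 m2 : nat) (a b y : int) (f : nat -> int).
Hypotheses (spl : splitting a b m1 m2) (mE : m = (m1 * m2)%N).

Let esol : nat -> 'Z_m1 :=
  explicit_sol a%:~R b%:~R y%:~R (fun n => (f n)%:~R).
Let isol : nat -> 'Z_m2 := implicit_sol a%:~R b%:~R (fun n => (f n)%:~R).

Lemma int_IP_explicit (x : nat -> int) : m1 <> 1%N ->
  int_IP m1 a b y f x <-> forall n, (x n)%:~R = esol n.
Proof.
case: spl => -[m1_gt0 _] _ co_b _ _ /(gt1_neq1 m1_gt0) m1_gt1.
rewrite -(IP_intrP (fun t => Zp_intr_eq0 t m1_gt1)).
by apply: explicit_solP; rewrite Zp_intr_unit.
Qed.

(** The recurrence already determines [x 0], so the initial condition turns into a constraint on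
    [y]. *)
Lemma int_IP_implicit (x : nat -> int) : m2 <> 1%N ->
  int_IP m2 a b y f x <->
  (forall n, (x n)%:~R = isol n) /\ y%:~R = isol 0%N.
Proof.
case: spl => -[_ m2_gt0] _ _ co_a [k k_gt0 dvd_b] /(gt1_neq1 m2_gt0) m2_gt1.
rewrite -(IP_intrP (fun t => Zp_intr_eq0 t m2_gt1)).
have uA : (a%:~R : 'Z_m2) \is a GRing.unit by rewrite Zp_intr_unit.
have solP := implicit_solP _ _ uA k_gt0 (Zp_intr_nilpotent m2_gt1 dvd_b).
split=> [[/solP eqx x0] | [eqx y0]]; first by rewrite -x0 eqx.
by split; [apply/solP | rewrite eqx -y0].
Qed.

(** The guards matter: a factor 1 imposes no condition, whereas ['Z_1] is Z/2Z and would impose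
    one. *)
Lemma int_IP_splitting (x : nat -> int) :
  int_IP m a b y f x <->
  (m1 <> 1%N -> forall n, (x n)%:~R = esol n) /\
  (m2 <> 1%N -> (forall n, (x n)%:~R = isol n) /\ y%:~R = isol 0%N).
Proof.
have [_ co12 _ _ _] := spl; rewrite mE int_IP_mul //; split=> [[x1 x2]|[x1 x2]].
  by split=> [n1|n2]; [apply/int_IP_explicit | apply/int_IP_implicit].
split.
  have [->|/eqP n1] := eqVneq m1 1%N; first exact: int_IP1.
  by apply/int_IP_explicit => //; apply: x1.
have [->|/eqP n2] := eqVneq m2 1%N; first exact: int_IP1.
by apply/int_IP_implicit => //; apply: x2.
Qed.

Lemma int_IP_uniq (x x' : nat -> int) n :
  int_IP m a b y f x -> int_IP m a b y f x' ->
  (m %| x n - x' n)%Z.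
Proof.
have [[m1_gt0 m2_gt0] co12 _ _ _] := spl.
move=> /int_IP_splitting[x1 x2] /int_IP_splitting[x'1 x'2].
rewrite mE PoszM Gauss_dvdz //; apply/andP; split.
  have [->|/eqP n1] := eqVneq m1 1%N; first exact: dvd1z.
  have /(gt1_neq1 m1_gt0) m1_gt1 := n1.
  by apply/(intr_eqP (fun t => Zp_intr_eq0 t m1_gt1)); rewrite x1 // x'1.
have [->|/eqP n2] := eqVneq m2 1%N; first exact: dvd1z.
have /(gt1_neq1 m2_gt0) m2_gt1 := n2.
apply/(intr_eqP (fun t => Zp_intr_eq0 t m2_gt1)).
by rewrite (x2 n2).1 (x'2 n2).1.
Qed.

Lemma CRT_lift (u : 'Z_m1) (v : 'Z_m2) : exists t : int,
  (m1 <> 1%N -> t%:~R = u) /\ (m2 <> 1%N -> t%:~R = v).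
Proof.
have [[m1_gt0 m2_gt0] co12 _ _ _] := spl.
exists (zchinese m1 m2 (nat_of_ord u) (nat_of_ord v)); split.
  move=> /(gt1_neq1 m1_gt0) m1_gt1; rewrite -[RHS]Zp_intr_repr.
  apply/(intr_eqP (fun t => Zp_intr_eq0 t m1_gt1)).
  by rewrite -eqz_mod_dvd; apply/eqP/zchinese_modl.
move=> /(gt1_neq1 m2_gt0) m2_gt1; rewrite -[RHS]Zp_intr_repr.
apply/(intr_eqP (fun t => Zp_intr_eq0 t m2_gt1)).
by rewrite -eqz_mod_dvd; apply/eqP/zchinese_modr.
Qed.

(** The only obstruction is the initial value modulo [m2]; otherwise the two closed formulas are
    glued term by term. *)
Lemma int_IP_solvable :
  (exists x, int_IP m a b y f x) <->
  m2 = 1%N \/ m2 <> 1%N /\ y%:~R = isol 0%N.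
Proof.
split=> [[x /int_IP_splitting[_ x2]]|cond].
  by have [|/eqP n2] := eqVneq m2 1%N; [left | right; have [] := x2 n2].
have [x xP] := choice (fun n => CRT_lift (esol n) (isol n)).
exists x; apply/int_IP_splitting; split=> [n1 n|n2]; first by apply: (xP n).1.
by split=> [n|]; [apply: (xP n).2 | case: cond => [/n2|[]]].
Qed.

(** Modulo each factor one summand of [psi] vanishes and the cofactor in the other cancels against
    its inverse. *)
Lemma psi_intr (t : int) (u : 'Z_m1) (v : 'Z_m2) : m1 <> 1%N -> m2 <> 1%N ->
  t%:~R = u -> t%:~R = v -> t%:~R = psi m u v.
Proof.
have [[m1_gt0 m2_gt0] co12 _ _ _] := spl.
move=> /(gt1_neq1 m1_gt0) m1_gt1 /(gt1_neq1 m2_gt0) m2_gt1 tu tv.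
have m_gt1 : (1 < m)%N by rewrite mE (leq_trans m1_gt1) // leq_pmulr.
rewrite /psi pmulrn; apply/(intr_eqP (fun t => Zp_intr_eq0 t m_gt1)).
rewrite mE PoszM Gauss_dvdz //; apply/andP; split.
  apply/(intr_eqP (fun t => Zp_intr_eq0 t m1_gt1)).
  rewrite -pmulrn natrD !natrM !natr_Zp pchar_Zp // mulr0 addr0.
  by rewrite mulrVK // unitZpE.
apply/(intr_eqP (fun t => Zp_intr_eq0 t m2_gt1)).
rewrite -pmulrn natrD !natrM !natr_Zp pchar_Zp // mulr0 add0r.
by rewrite mulrVK // unitZpE // coprime_sym.
Qed.

End Coprime.

(** * Dividing the recurrence by the common divisor *)

Section Reduction.

Variables (d m : nat) (a b y : int) (f : nat -> int).
Hypothesis d_gt0 : (0 < d)%N.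

Let f' n := (f n %/ d)%Z.

(** Here [a] and [b] stand for the quotients by [d]. The initial condition is not divided, so it
    keeps the full modulus [d * m]. *)
Lemma int_IP_reduce (x : nat -> int) :
  int_IP (d * m) (a * d) (b * d) y f x <->
  [/\ forall n, (d %| f n)%Z, int_IP m a b y f' x & ((d * m)%N %| x 0%N - y)%Z].
Proof.
have d_neq0 : (d : int) != 0 by rewrite -lt0n.
have recE n : f n = f' n * d ->
    ((d * m)%N %| b * d * x n.+1 - (a * d * x n + f n))%Z =
    (m %| b * x n.+1 - (a * x n + f' n))%Z.
  move=> fE; rewrite {1}fE PoszM -[RHS](dvdz_mul2l d_neq0).
  by congr (dvdz _ _); ring.
split=> [[recx x0]|[df [recx x0] x0']]; last first.
  by split=> // n; rewrite recE ?recx // divzK.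
have df n : (d %| f n)%Z.
  have -> : f n = (b * x n.+1 - a * x n) * d
                  - (b * d * x n.+1 - (a * d * x n + f n)) by ring.
  rewrite rpredD ?dvdz_mull // rpredN; apply: dvdz_trans (recx n).
  by rewrite PoszM dvdz_mulr.
split=> //; split=> [n|]; first by rewrite -recE ?recx // divzK.
by apply: dvdz_trans x0; rewrite PoszM dvdz_mull.
Qed.

Variables (m1 m2 : nat).
Hypotheses (spl : splitting a b m1 m2) (mE : m = (m1 * m2)%N).

(** Uniqueness modulo [m] forces agreement with [x']; conversely the reduced recurrence only sees
    residues modulo [m]. *)
Lemma int_IP_general (x x' : nat -> int) : (forall n, (d %| f n)%Z) ->
  int_IP m a b y f' x' ->
  int_IP (d * m) (a * d) (b * d) y f x <->
  ((d * m)%N %| x 0%N - y)%Z /\ forall n, (m %| x n.+1 - x' n.+1)%Z.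
Proof.
move=> df IPx'; rewrite int_IP_reduce; split=> [[_ IPx x0]|[x0 xx']].
  by split=> // n; apply: (int_IP_uniq spl mE n.+1 IPx IPx').
have x0y : (m %| x 0%N - y)%Z by apply: dvdz_trans x0; rewrite PoszM dvdz_mull.
have [recx' x'0] := IPx'.
have dvd_xx' n : (m %| x n - x' n)%Z.
  by case: n => // ; rewrite -[x 0%N](subrK y) -addrA rpredD // -rpredN opprB.
split=> //; split=> // n.
have -> : b * x n.+1 - (a * x n + f' n) = b * (x n.+1 - x' n.+1)
    - a * (x n - x' n) + (b * x' n.+1 - (a * x' n + f' n)) by ring.
by rewrite rpredD ?recx' ?rpredB ?dvdz_mull.
Qed.

Lemma int_IP_reduce_solvable :
  (exists x, int_IP (d * m) (a * d) (b * d) y f x) <->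
  (forall n, (d %| f n)%Z) /\ exists x, int_IP m a b y f' x.
Proof.
split=> [[x /int_IP_reduce[df IPx _]]|[df [x IPx]]]; first by split=> //; exists x.
(* A solution modulo [m] starts at [y] only modulo [m], so its initial term is replaced by [y]
   itself. *)
exists (fun n => if n is 0 then y else x n).
by apply/(int_IP_general _ df IPx); rewrite subrr dvdz0; split=> // n; rewrite subrr.
Qed.

End Reduction.

(** * Digits of lifted residues, and infinite families *)

Lemma residue_digit (d m : nat) (u v : int) : (0 < d)%N -> (0 < m)%N ->
  (m %| u - v)%Z ->
  exists! k : 'I_d, ((d * m)%N %| u - (v + (k * m)%N))%Z.
Proof.
move=> d_gt0 m_gt0 /dvdzP[q uvE].
have m_neq0 : (m : int) != 0 by rewrite -lt0n.
(* With [u - v = q * m], cancelling [m] leaves [q = k] modulo [d]; the digit is therefore the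
   remainder of [q]. *)
have dvdE (k : 'I_d) : ((d * m)%N %| u - (v + (k * m)%N))%Z = (q == k %[mod d])%Z.
  rewrite eqz_mod_dvd -[RHS](dvdz_mul2r m_neq0) !PoszM; congr (dvdz _ _).
  by rewrite opprD addrA uvE; ring.
have r_ge0 : (0 <= q %% d)%Z by rewrite modz_ge0 // -lt0n.
have r_ltd : (`|q %% d|%Z < d)%N by rewrite -ltz_nat gez0_abs // ltz_pmod.
exists (Ordinal r_ltd); split=> [|k].
  by rewrite dvdE /= gez0_abs // modz_mod.
rewrite dvdE => /eqP qk; apply: val_inj => /=.
by rewrite qk modz_nat modn_small.
Qed.

Lemma injective_infinite_set (T : Type) (P : set T) (g : nat -> T) :
  injective g -> (forall k, P (g k)) -> infinite_set P.
Proof.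
move=> g_inj gP finP; apply: infinite_nat.
rewrite -(eq_finite_set (@inj_card_eq _ _ setT g (in2W g_inj))).
by apply: sub_finite_set finP => _ [k _ <-].
Qed.

Theorem theorem3p1 (m : nat) (a b y0 : int) (f : nat -> int) (hm : (2 <= m)%N) :
  let m1 := (\prod_(p <- primes m | ~~ (p %| b)%Z) p ^ logn p m)%N in
  let m2 := (\prod_(p <- primes m | (p %| b)%Z) p ^ logn p m)%N in
  let d := gcdn (gcdn `|a|%N `|b|%N) m in
  let m' := (m %/ d)%N in
  let m2' := (\prod_(p <- primes m | ((d * p)%N %| b)%Z) p ^ logn p m')%N in
  let A : 'Z_m := a%:~R in
  let B : 'Z_m := b%:~R in
  let Y0 : 'Z_m := y0%:~R in
  let F (n : nat) : 'Z_m := (f n)%:~R in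
  let A1 : 'Z_m1 := a%:~R in
  let B1 : 'Z_m1 := b%:~R in
  let Y10 : 'Z_m1 := y0%:~R in
  let F1 (n : nat) : 'Z_m1 := (f n)%:~R in
  let A2 : 'Z_m2 := a%:~R in
  let B2 : 'Z_m2 := b%:~R in
  let Y20 : 'Z_m2 := y0%:~R in
  let F2 (n : nat) : 'Z_m2 := (f n)%:~R in
  let A' : Zmod m' := (a %/ d)%Z%:~R in
  let B' : Zmod m' := (b %/ d)%Z%:~R in
  let Y0' : Zmod m' := y0%:~R in
  let F' (n : nat) : Zmod m' := (f n %/ d)%Z%:~R in
  let A2' : 'Z_m2' := (a %/ d)%Z%:~R in
  let B2' : 'Z_m2' := (b %/ d)%Z%:~R in
  let Y20' : 'Z_m2' := y0%:~R in
  let F2' (n : nat) : 'Z_m2' := (f n %/ d)%Z%:~R in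
  let sol := IP A B Y0 F in
  let star := Y20' = - \sum_(0 <= s < ind B2') A2' ^- s.+1 * B2' ^+ s * F2' s in
  (* 1 *)
  [/\ (exists! X, sol X) <->
        d = 1%N /\
        (m2 = 1%N \/
         m2 <> 1%N /\
         Y20 = - \sum_(0 <= s < ind B2) A2 ^- s.+1 * B2 ^+ s * F2 s),
      (exists! X, sol X) ->
        [/\ m2 = 1%N -> unique sol (fun n => explicit_sol A B Y0 F n),
            m1 = 1%N -> unique sol (fun n => implicit_sol A B F n) &
            m1 <> 1%N -> m2 <> 1%N ->
              unique sol (fun n => psi m (explicit_sol A1 B1 Y10 F1 n)
                                         (implicit_sol A2 B2 F2 n))],
  (* 2 *)
      infinite_set [set X | sol X]%classic <->
        [/\ d <> 1%N, forall n, (d %| f n)%Z & m2' = 1%N \/ m2' <> 1%N /\ star],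
      infinite_set [set X | sol X]%classic ->
        (exists! X', IP A' B' Y0' F' X') /\
        (forall x' : nat -> int, IP A' B' Y0' F' (fun n => (x' n)%:~R) ->
           (* [alpha n] is the term of index n + 1 of the sequence *)
           let param (X : nat -> 'Z_m) (alpha : nat -> 'I_d) :=
             X 0%N = Y0 /\
             forall n, X n.+1 = (x' n.+1 + (alpha n * m')%N)%:~R in
           (forall X, sol X <-> exists alpha, param X alpha) /\
           (forall X, sol X -> exists! alpha, param X alpha)) &
  (* 3 *)
      ~ (exists X, sol X) <->
        (exists n, ~~ (d %| f n)%Z) \/
        [/\ forall n, (d %| f n)%Z, m2' <> 1%N & ~ star]].
Proof.
move=> m1 m2 d m' m2' A B Y0 F A1 B1 Y10 F1 A2 B2 Y20 F2 A' B' Y0' F'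
  A2' B2' Y20' F2' sol star.
have m_gt0 : (0 < m)%N by rewrite ltnW.
have d_gt0 : (0 < d)%N by rewrite gcdn_gt0 m_gt0 orbT.
have mE : m = (d * m')%N by rewrite mulnC divnK ?dvdn_gcdr.
have dvd_dE u : (u %| d)%N = [&& (u %| a)%Z, (u %| b)%Z & (u %| m)%N].
  by rewrite !dvdn_gcd andbA.
have [da db _] : [/\ (d %| a)%Z, (d %| b)%Z & (d %| m)%N].
  by apply/and3P; rewrite -dvd_dE.
have m2'E : m2' = (\prod_(p <- primes m | (p %| (b %/ d))%Z) p ^ logn p m')%N.
  apply: eq_bigl => p.
  by rewrite -{1}(divzK db) mulnC PoszM dvdz_mul2r // -lt0n.
have spl : d = 1%N -> splitting a b m1 m2 /\ m = (m1 * m2)%N.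
  move=> d1; apply: prod_primes_splitting => // p pr_p pm pa.
  apply: contraL pr_p => pb; have := dvd_dE p.
  by rewrite pa pb pm d1 dvdn1 => /eqP->.
pose m1' := (\prod_(p <- primes m | ~~ (p %| (b %/ d))%Z) p ^ logn p m')%N.
(* From here on the moduli are known only through the facts just established. *)
clearbody d m' m1 m2 m2'.
have m'_gt0 : (0 < m')%N by move: m_gt0; rewrite {1}mE muln_gt0 => /andP[].
have dm' : (m' %| m)%N by rewrite mE dvdn_mull.
have [spl' m'E] : splitting (a %/ d)%Z (b %/ d)%Z m1' m2' /\ m' = (m1' * m2')%N.
  rewrite m2'E; apply: prod_primes_splitting => // p pr_p pm' pa.
  apply/negP => pb.
  (* A common prime [p] of [m'], [a / d] and [b / d] would make [d * p] a common divisor of [a], [b]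
     and [m]. *)
  have : (d * p %| d)%N.
    have dpE u : (d %| u)%Z -> (p %| (u %/ d))%Z -> ((d * p)%N %| u)%Z.
      by move=> du pu; rewrite -(divzK du) mulrC PoszM dvdz_mul.
    by rewrite dvd_dE !dpE //= mE dvdn_mul.
  rewrite -{2}[d]muln1 dvdn_pmul2l // dvdn1 => /eqP p1.
  by rewrite p1 in pr_p.
clearbody m1'.
have sol_intr (x : nat -> int) :
    sol (fun n => (x n)%:~R) <-> int_IP m a b y0 f x.
  exact: (IP_intrP (fun t => Zp_intr_eq0 t hm)).
have solE (x : nat -> int) : int_IP m a b y0 f x <->
    int_IP (d * m') ((a %/ d)%Z * d) ((b %/ d)%Z * d) y0 f x.
  by rewrite !divzK // -mE.
have liftE (X : nat -> 'Z_m) : exists x : nat -> int, X = fun n => (x n)%:~R.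
  by exists (fun n => nat_of_ord (X n)); apply/funext => n; rewrite Zp_intr_repr.
have sol'_intr (x : nat -> int) : IP A' B' Y0' F' (fun n => (x n)%:~R) <->
    int_IP m' (a %/ d)%Z (b %/ d)%Z y0 (fun n => (f n %/ d)%Z) x.
  exact: (IP_intrP (fun t => Zmod_intr_eq0 t m'_gt0)).
have solvable' : (exists x,
    int_IP m' (a %/ d)%Z (b %/ d)%Z y0 (fun n => (f n %/ d)%Z) x) <->
    m2' = 1%N \/ m2' <> 1%N /\ star.
  exact: (int_IP_solvable y0 _ spl' m'E).
have solvable : (exists X, sol X) <->
    (forall n, (d %| f n)%Z) /\ (m2' = 1%N \/ m2' <> 1%N /\ star).
  rewrite -solvable' -(int_IP_reduce_solvable y0 f d_gt0 spl' m'E).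
  split=> [[X solX]|[x /solE/sol_intr solx]]; last by eexists; exact: solx.
  have [x XE] := liftE X; exists x; apply/solE/sol_intr; by rewrite -XE.
have general x' : (forall n, (d %| f n)%Z) ->
    IP A' B' Y0' F' (fun n => (x' n)%:~R) -> forall x,
    sol (fun n => (x n)%:~R) <->
    (x 0%N)%:~R = Y0 /\ forall n, (m' %| x n.+1 - x' n.+1)%Z.
  move=> df /sol'_intr IPx' x.
  rewrite sol_intr solE (int_IP_general d_gt0 spl' m'E x df IPx') -mE.
  by rewrite (intr_eqP (fun t => Zp_intr_eq0 t hm)).
have uniq_sol X X' : d = 1%N -> sol X -> sol X' -> X = X'.
  move=> /spl[spl1 m12]; have [x ->] := liftE X; have [x' ->] := liftE X'.
  move=> /sol_intr IPx /sol_intr IPx'; apply/funext => n.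
  apply/(intr_eqP (fun t => Zp_intr_eq0 t hm)).
  exact: (int_IP_uniq spl1 m12 n IPx IPx').
have infinite_sol :
    d <> 1%N -> (exists X, sol X) -> infinite_set [set X | sol X]%classic.
  move=> d_neq1 /solvable[df /solvable'[x' IPx']].
  (* The solution [g k] adds [m'] at index [k.+1] only. As [d > 1], [m'] is nonzero modulo [m], so
     these solutions are pairwise distinct. *)
  pose g k n := if n is n'.+1 then x' n'.+1 + (n' == k)%:Z * m' else y0.
  apply: (@injective_infinite_set _ _ (fun k n => (g k n)%:~R)); last first.
    move=> k; apply/(general x' df); first exact/sol'_intr.
    by split=> // n; rewrite /g addrC addKr dvdz_mull.
  move=> k j /(congr1 (fun X => X k.+1)) /=; rewrite eqxx.
  have [->//|_] := eqVneq k j; move/(intr_eqP (fun t => Zp_intr_eq0 t hm)).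
  rewrite mul1r mul0r addr0 addrC addKr dvdzE /= => /(dvdn_leq m'_gt0).
  rewrite {1}mE -{2}[m']mul1n leq_pmul2r // => d_le1.
  by case: d_neq1; apply/eqP; rewrite eqn_leq d_le1.
have infinite_nonempty : infinite_set [set X | sol X]%classic ->
    d <> 1%N /\ exists X, sol X.
  move=> infX; have [X solX] := infinite_setN0 infX; split; last by exists X.
  move=> d1; apply: infX; apply: (@sub_finite_set _ _ [set X]%classic) => //.
  by move=> X' solX' /=; apply: uniq_sol.
(* If [d] were not 1, one solution would already yield infinitely many. *)
have unique_d1 : (exists! X, sol X) -> d = 1%N.
  move=> [X [solX uniqX]]; apply: contrapT => d_neq1.
  apply: (infinite_sol d_neq1); first by exists X.
  by apply: (@sub_finite_set _ _ [set X]%classic) => // X' /uniqX ->.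
have solvable1 : d = 1%N -> (exists X, sol X) <->
    m2 = 1%N \/ m2 <> 1%N /\
      Y20 = - \sum_(0 <= s < ind B2) A2 ^- s.+1 * B2 ^+ s * F2 s.
  move=> /spl[spl1 m12]; rewrite -(int_IP_solvable y0 f spl1 m12).
  split=> [[X solX]|[x /sol_intr solx]]; last by eexists; exact: solx.
  by have [x XE] := liftE X; exists x; apply/sol_intr; rewrite -XE.
split.
- split=> [uniqX|[d1 /(solvable1 d1)[X solX]]].
    split; first exact: unique_d1.
    by apply/(solvable1 (unique_d1 uniqX)); have [X [solX _]] := uniqX; exists X.
  by exists X; split=> // X' solX'; apply: uniq_sol.
- move=> uniqX; have [spl1 m12] := spl (unique_d1 uniqX).
  have [X uX] := uniqX; have [solX _] := uX; have [x XE] := liftE X.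
  have IPx : int_IP m a b y0 f x by apply/sol_intr; rewrite -XE.
  have [_ _ co_b co_a [k k_gt0 dvd_b]] := spl1.
  split=> [m21|m11|n1 n2].
  (* Uniqueness of [X] is known, so each formula only has to equal [X]. Here [m = m1], which makes
     [B] a unit. *)
  + suff -> : (fun n => explicit_sol A B Y0 F n) = X by [].
    rewrite m21 muln1 in m12; apply/funext => n; apply/esym; move: n.
    by apply/explicit_solP; rewrite // Zp_intr_unit // m12.
  + suff -> : (fun n => implicit_sol A B F n) = X by [].
    rewrite m11 mul1n in m12; apply/funext => n; apply/esym; move: n.
    apply/(implicit_solP _ _ _ k_gt0); last by case: solX.
      by rewrite Zp_intr_unit // m12.
    by apply: Zp_intr_nilpotent => //; rewrite m12.
  suff -> : (fun n => psi m (explicit_sol A1 B1 Y10 F1 n)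
                            (implicit_sol A2 B2 F2 n)) = X by [].
  have /(int_IP_splitting _ _ spl1 m12)[x1 x2] := IPx.
  rewrite XE; apply/funext => n; apply/esym.
  by apply: (psi_intr spl1 m12) => //; [apply: x1 | apply: (x2 n2).1].
- split=> [/infinite_nonempty[d_neq1 /solvable[df cond]]|[d_neq1 df cond]] //.
  by apply: infinite_sol => //; apply/solvable.
- move=> /infinite_nonempty[_ /solvable[df /solvable'[x0 IPx0]]].
  split.
    exists (fun n => (x0 n)%:~R); split=> [|X']; first exact/sol'_intr.
    have -> : X' = fun n => (nat_of_ord (X' n))%:Z%:~R.
      by apply/funext => n; rewrite Zmod_intr_repr.
    move=> /sol'_intr IPX'; apply/funext => n.
    apply/(intr_eqP (fun t => Zmod_intr_eq0 t m'_gt0)).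
    exact: (int_IP_uniq spl' m'E n IPx0 IPX').
  move=> x' IPx' param.
  (* A solution agrees with [x'] modulo [m'] at each positive index, which leaves exactly one digit
     there; index 0 carries none. *)
  have digits X : sol X -> exists! alpha, param X alpha.
    have [x ->] := liftE X => /(general _ df IPx')[x0y xx'].
    have [al alP] := choice (fun n => residue_digit d_gt0 m'_gt0 (xx' n)).
    exists al; split=> [|be [_ beP]].
      split=> // n; apply/(intr_eqP (fun t => Zp_intr_eq0 t hm)).
      by rewrite {1}mE; case: (alP n).
    apply/funext => n; apply: (alP n).2; rewrite -mE.
    exact/(intr_eqP (fun t => Zp_intr_eq0 t hm)).
  split=> // X; split=> [/digits[al [alP _]]|[al [X0 XS]]]; first by exists al.
  have [x XE] := liftE X; rewrite {}XE in X0 XS *.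
  apply/(general _ df IPx'); split=> // n.
  have /(intr_eqP (fun t => Zp_intr_eq0 t hm)) := XS n.
  (* Reducing the congruence from [m] to [m'] removes the digit term. *)
  have dm'z : (Posz m' %| Posz m)%Z := dm'; move=> /(dvdz_trans dm'z).
  by rewrite opprD addrA PoszM rpredBr ?dvdz_mull.
- rewrite solvable; split=> [nsol|[[n /negP ndf] [df _]|[_ n2 nstar] [_ [|[]]]] //].
  have [df|/existsNP[n /negP ndf]] := pselect (forall n, (d %| f n)%Z); last first.
    by left; exists n.
  right; split=> // [m21|st]; apply: nsol; split=> //; first by left.
  by have [|/eqP n2] := eqVneq m2' 1%N; [left | right].
Qed.
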